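(* A countable equivalence structure $\mathcal{A}$ is weakly ultrahomogeneous if and only if all but finitely many equivalence classes of $\mathcal{A}$ have the same size. In this case, a minimal exceptional set contains exactly one element from each of the exceptional equivalence classes.
   Context: Structures are countably infinite unless otherwise stated. An equivalence structure $\mathcal{A}=(A,E)$ is a set $A$ with a single equivalence relation $E$. The size of an equivalence class is its cardinality, finite or $\aleph_0$. When all but finitely many equivalence classes of $\mathcal{A}$ have the same size, the exceptional equivalence classes are the finitely many remaining classes, those not of this common size. For a tuple $\vec{x}$ from $A$, $\langle\vec{x}\rangle$ denotes the substructure generated by $\vec{x}$ (here just the finite substructure on the elements of $\vec{x}$). A finite set $\{a_1,\dots,a_n\}\subseteq A$ is an exceptional set of $\mathcal{A}$ if for all tuples $\vec{x},\vec{y}$ from $A$ with $\langle\vec{a},\vec{x}\rangle\cong\langle\vec{a},\vec{y}\rangle$ via an isomorphism fixing each $a_i$ and sending $x_j$ to $y_j$, this isomorphism extends to an automorphism of $\mathcal{A}$. The structure $\mathcal{A}$ is weakly ultrahomogeneous if it has an exceptional set. An exceptional set is minimal if no proper subset of it is exceptional.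
   Formalization: If there are only finitely many equivalence classes, the common size is not unique; the second claim is then proved for some common size depending on the minimal exceptional set. With infinitely many classes it is proved for the unique common size. *)

(* Defs.v *)
From Corelib Require Import RelationClasses.
From mathcomp Require Import all_boot.
From mathcomp Require Import boolp classical_sets functions cardinality.

Set Implicit Arguments.
Unset Strict Implicit.
Unset Printing Implicit Defensive.

Local Open Scope classical_set_scope.
Local Open Scope card_scope.

Record equivStructure := EquivStructure {
  carrier :> Type;
  erel : carrier -> carrier -> Prop;
  erel_equiv : Equivalence erel;
  carrier_countably_infinite : [set: carrier] #= [set: nat] }.

Definition classes (A : equivStructure) : set (set A) :=
  [set C | exists a : A, C = [set b | erel a b]].

Arguments classes : clear implicits.

Inductive class_size := Fin of nat | Aleph0.

Definition has_size (T : Type) (C : set T) (k : class_size) : Prop :=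
  match k with
  | Fin n => C #= `I_n
  | Aleph0 => C #= [set: nat]
  end.

Definition exceptional_classes (A : equivStructure) (k : class_size) : set (set A) :=
  [set C | classes A C /\ ~ has_size C k].

Arguments exceptional_classes : clear implicits.

(* The first clause only matters when A has finitely many classes: it rules out
   sizes that no class has.  When A has infinitely many classes it follows from
   the second one, and k is unique (common_size_unique). *)
Definition common_size (A : equivStructure) (k : class_size) : Prop :=
  (exists2 C : set A, classes A C & has_size C k) /\
  finite_set (exceptional_classes A k).

(* f is only relevant on X.  The language is relational, so X and Y are
   themselves the substructures that they generate. *)
Definition isomorphism (A : equivStructure) (X Y : set A) (f : A -> A) : Prop :=
  set_bij X Y f /\
  (forall u v, X u -> X v -> (erel u v <-> erel (f u) (f v))).

Definition automorphism (A : equivStructure) (g : A -> A) : Prop :=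
  isomorphism setT setT g.

Definition exceptional_set (A : equivStructure) (S : set A) : Prop :=
  finite_set S /\
  forall (n : nat) (x y : 'I_n -> A) (f : A -> A),
    isomorphism (S `|` range x) (S `|` range y) f ->
    (forall a, S a -> f a = a) ->
    (forall j, f (x j) = y j) ->
    exists2 g : A -> A, automorphism g &
      forall u, (S `|` range x) u -> g u = f u.

Definition weakly_ultrahomogeneous (A : equivStructure) : Prop :=
  exists S : set A, exceptional_set S.

Definition minimal_exceptional_set (A : equivStructure) (S : set A) : Prop :=
  exceptional_set S /\ forall S' : set A, S' `<` S -> ~ exceptional_set S'.

Definition one_from_each (T : Type) (S : set T) (F : set (set T)) : Prop :=
  forall C, F C -> exists! x, S x /\ C x.

Lemma has_size_unique (T : Type) (C : set T) (k l : class_size) :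
  has_size C k -> has_size C l -> k = l.
Proof.
have abs n : (C #= `I_n) -> (C #= [set: nat]) -> False.
  move=> Cn CN; apply: infinite_nat; exists n.
  by rewrite -(card_eql CN).
case: k => [m|]; case: l => [n|] //= Ck Cl.
- by congr Fin; apply/card_eq_II; rewrite -(card_eql Ck).
- by case: (abs m).
- by case: (abs n).
Qed.

Lemma common_size_unique (A : equivStructure) (k l : class_size) :
  infinite_set (classes A) -> common_size A k -> common_size A l -> k = l.
Proof.
move=> inf [_ fk] [_ fl]; apply: contrapT => kl; apply: inf.
apply: (@sub_finite_set _ _ (exceptional_classes A k `|` exceptional_classes A l)).
  move=> C CA; case: (pselect (has_size C k)) => Ck; [right|by left].
  by split=> // Cl; apply: kl; apply: has_size_unique Ck Cl.
by rewrite finite_setU.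
Qed.

(* Main.v *)
Require Import Defs.
From HB Require Import structures.
From mathcomp Require Import all_boot.
From mathcomp Require Import boolp classical_sets functions cardinality.

Local Open Scope classical_set_scope.

(** The point is a concrete criterion: a finite set [S] is exceptional iff all
    the classes disjoint from [S] have the same size ([exceptional_setP]).

    An automorphism preserves the sizes of classes, and if the classes of two
    points are disjoint from [S], then some partial isomorphism fixing [S] sends
    one point to the other; so the condition is necessary.  Conversely, under the condition a finite partial
    isomorphism [f] fixing [S] sends each point [u] to a point whose class is as
    large as that of [u], and every such [f] extends: correct an automorphism on
    one point of the domain at a time ([extend_partial_isomorphism]), each time
    composing with an automorphism that moves a prescribed point to another one
    and fixes the finitely many points already dealt with ([move_point]).  Two
    kinds of involution suffice for the correction: the exchange of two related
    points, and the exchange of two whole classes of the same size.  Working with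
    automorphisms of the whole structure throughout avoids all counting, both of
    the points left in a class and of the classes left of a given size.

    Given the criterion, if [S] is exceptional then the size of a class disjoint
    from [S] is common, since every class of another size meets the finite set
    [S]; if all classes meet [S], there are finitely many of them and the size
    of any class will do.  Conversely, representatives of the exceptional classes form an
    exceptional set.  If [S] is minimal, it has no two related points, as either
    could be dropped; and some class is disjoint from [S], as otherwise dropping
    any point of [S] would leave at most one class disjoint from the rest.  The size
    of this class is the common size sought. *)

(** * Sizes *)

Lemma set_bij_of_card (T U : Type) (u : U) (X : set T) (Y : set U) :
  (X #= Y)%card -> exists f : T -> U, set_bij X Y f.
Proof.
pose V : pointedType := HB.pack U (gen_eqMixin U) (gen_choiceMixin U)
  (isPointed.Build U u).
by move=> /(@card_set_bijP T V X Y).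
Qed.

Lemma has_size_card {T : Type} {C D : set T} {k : class_size} :
  has_size C k -> has_size D k -> (C #= D)%card.
Proof.
case: k => [n|] /= Ck Dk; apply: (card_eq_trans Ck); exact: card_esym.
Qed.

Lemma card_has_size {T : Type} {C D : set T} {k : class_size} :
  (C #= D)%card -> has_size C k -> has_size D k.
Proof.
move=> /card_esym DC; case: k => [n|] /= Ck; exact: card_eq_trans DC Ck.
Qed.

Section EquivStructure.
Variable A : equivStructure.
Implicit Types (a b c d u v w : A) (S X Y C : set A) (g f : A -> A).

Lemma erel_refl a : erel a a.
Proof. by case: (erel_equiv A). Qed.

Lemma erel_sym {a b} : erel a b -> erel b a.
Proof. by case: (erel_equiv A) => _ h _; apply: h. Qed.

Lemma erel_trans {a b c} : erel a b -> erel b c -> erel a c.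
Proof. by case: (erel_equiv A) => _ _ h; apply: h. Qed.

Hint Resolve erel_refl : core.

Definition class_of a : set A := [set b | erel a b].

Lemma class_of_eq a b : erel a b -> class_of a = class_of b.
Proof.
move=> ab; apply/seteqP; split=> c /=; [exact: (erel_trans (erel_sym ab))|].
exact: (erel_trans ab).
Qed.

Lemma ex_has_size C : exists k : class_size, has_size C k.
Proof.
have [/finite_setP[n Cn]|infC] := pselect (finite_set C); first by exists (Fin n).
exists Aleph0; apply: eq_card_nat infC.
apply: sub_countable (countableP [set: nat]).
apply: (card_le_trans (subset_card_le (@subsetT _ C))).
by rewrite (card_le_eql (carrier_countably_infinite A)).
Qed.

(** * Automorphisms moving one point *)

Lemma automorphism_id : automorphism (@id A).
Proof. by split=> //; rewrite setTT_bijective; exists id. Qed.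

Lemma automorphism_comp g g' :
  automorphism g -> automorphism g' -> automorphism (g' \o g).
Proof.
rewrite /automorphism /isomorphism !setTT_bijective => -[bg rg] [bg' rg'].
by split=> [|u v _ _ /=]; [exact: bij_comp | rewrite rg// rg'].
Qed.

Lemma automorphism_involution g :
  (forall u, g (g u) = u) -> (forall u v, erel u v -> erel (g u) (g v)) ->
  automorphism g.
Proof.
move=> gg rg; split; first by rewrite setTT_bijective; exists g.
move=> u v _ _; split; first exact: rg.
by move=> /rg; rewrite !gg.
Qed.

Lemma card_class_automorphism g u :
  automorphism g -> (class_of u #= class_of (g u))%card.
Proof.
rewrite /automorphism /isomorphism setTT_bijective => -[[g' gK g'K] rg].
have rgT v w : erel v w <-> erel (g v) (g w) by exact: rg.
have -> : class_of (g u) = g @` class_of u.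
  apply/seteqP; split=> [v /= guv|_ [v /= uv <-]]; last exact: (rgT u v).1.
  by exists (g' v) => //=; apply/rgT; rewrite g'K.
apply/card_esym/inj_card_eq => x y _ _; exact: can_inj gK x y.
Qed.

Lemma exchange_related_points v w : erel v w ->
  exists2 t : A -> A, automorphism t &
    t v = w /\ forall u, u <> v -> u <> w -> t u = u.
Proof.
move=> vw; pose t u := if pselect (u = v) then w else
                       if pselect (u = w) then v else u.
have tE u : [\/ u = v /\ t u = w, u = w /\ t u = v |
                [/\ u <> v, u <> w & t u = u]].
  rewrite /t; case: pselect => [uv|nuv]; first by constructor 1.
  by case: pselect => [uw|nuw]; [constructor 2 | constructor 3].
have tv : t v = w by case: (tE v) => [[]|[->]|[]].
have tw : t w = v by case: (tE w) => [[->]|[]|[]].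
have rt u : erel u (t u).
  case: (tE u) => [[-> ->]|[-> ->]|[_ _ ->]] //; exact: erel_sym.
exists t; last by split=> // u uv uw; case: (tE u) => [[]|[]|[]].
apply: automorphism_involution => [u|u u' uu'].
  by case: (tE u) => [[-> ->]|[-> ->]|[_ _ tu]] //; rewrite !tu.
exact: erel_trans (erel_sym (rt u)) (erel_trans uu' (rt u')).
Qed.

Lemma exchange_classes v w : ~ erel v w -> (class_of v #= class_of w)%card ->
  exists2 t : A -> A, automorphism t &
    erel w (t v) /\ forall u, ~ erel v u -> ~ erel w u -> t u = u.
Proof.
move=> nvw /(set_bij_of_card _ _ w)[h [hfun hinj hsurj]].
have hV u : exists u', erel w u -> erel v u' /\ h u' = u.
  have [/hsurj[u' vu' hu']|nwu] := pselect (erel w u); first by exists u'.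
  by exists u.
have [k kE] := choice hV.
have hw u : erel v u -> erel w (h u) by exact: hfun.
have nwv u : erel v u -> ~ erel w u.
  by move=> vu wu; exact: nvw (erel_trans vu (erel_sym wu)).
have hk u : erel v u -> k (h u) = u.
  move=> vu; have [vk hk] := kE _ (hw _ vu).
  by apply: hinj; rewrite ?inE.
(* k inverts h on the class of w, so t is an involution. *)
pose t u := if pselect (erel v u) then h u else
            if pselect (erel w u) then k u else u.
have tv u : erel v u -> t u = h u by rewrite /t; case: pselect.
have tw u : erel w u -> t u = k u.
  move=> wu; rewrite /t; case: pselect => [vu|nvu]; first by case: (nwv u).
  by case: pselect.
have tN u : ~ erel v u -> ~ erel w u -> t u = u.
  by rewrite /t; case: pselect => // nvu; case: pselect.
exists t; last by split=> //; rewrite tv//; exact: hw.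
have split3 u : [\/ erel v u, erel w u | ~ erel v u /\ ~ erel w u].
  have [|vu] := pselect (erel v u); first by constructor 1.
  by have [|wu] := pselect (erel w u); [constructor 2|constructor 3].
apply: automorphism_involution => [u|u u' uu'].
  case: (split3 u) => [vu|wu|[nv nw]]; last by rewrite !tN.
  - by rewrite (tv u)// tw ?hk//; exact: hw.
  - by rewrite (tw u)//; have [vk hku] := kE _ wu; rewrite tv.
case: (split3 u) => [vu|wu|[nv nw]].
- have vu' := erel_trans vu uu'; rewrite !tv//.
  exact: erel_trans (erel_sym (hw _ vu)) (hw _ vu').
- have wu' := erel_trans wu uu'; rewrite !tw//.
  exact: erel_trans (erel_sym (kE _ wu).1) (kE _ wu').1.
- have nv' : ~ erel v u' by move=> vu'; exact: nv (erel_trans vu' (erel_sym uu')).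
  have nw' : ~ erel w u' by move=> wu'; exact: nw (erel_trans wu' (erel_sym uu')).
  by rewrite !tN.
Qed.

(** If [v] and [w] are unrelated, no point of [Y] lies in their classes: it would
    be related to both.  So the classes can be exchanged, which sends [v] into
    the class of [w], and an exchange inside that class brings it to [w]. *)
Lemma move_point Y v w : ~ Y v -> ~ Y w ->
  (forall y, Y y -> (erel v y <-> erel w y)) ->
  (class_of v #= class_of w)%card ->
  exists2 t : A -> A, automorphism t & t v = w /\ forall y, Y y -> t y = y.
Proof.
move=> Yv Yw vwY vw.
have [rvw|nvw] := pselect (erel v w).
  have [t at_ [tv tN]] := exchange_related_points _ _ rvw.
  by exists t => //; split=> // y Yy; apply: tN => yE; rewrite yE in Yy.
have nY y : Y y -> ~ erel w y.
  move=> Yy wy; apply: nvw; apply: erel_trans (erel_sym wy).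
  exact/vwY.
have [t at_ [tv tN]] := exchange_classes _ _ nvw vw.
have [t' at' [t'v t'N]] := exchange_related_points _ _ (erel_sym tv).
exists (t' \o t); first exact: automorphism_comp.
split=> //= y Yy.
rewrite tN; [|by move=> /(vwY _ Yy); exact: nY|exact: nY].
by apply: t'N => yE; [apply: (nY y) => //; rewrite yE | rewrite yE in Yy].
Qed.

(** * The criterion for exceptional sets *)

(** Enumerate [X] as [e 0], ..., [e (n - 1)] and suppose that the automorphism [g]
    agrees with [f] on the first [m] points.  Since [g] and [f] both preserve and
    reflect the relation, [g (e m)] and [f (e m)] are related to the same points
    among the images already fixed, and their classes are both as large as that
    of [e m]; so [move_point] corrects [g] at [e m]. *)
Lemma extend_partial_isomorphism X Y f : finite_set X -> isomorphism X Y f ->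
  (forall u, X u -> (class_of u #= class_of (f u))%card) ->
  exists2 g : A -> A, automorphism g & forall u, X u -> g u = f u.
Proof.
move=> finX [[_ finj _] frel] fcard.
have [X0|/set0P[a0 _]] := eqVneq X set0.
  by exists id; [exact: automorphism_id | move=> u; rewrite X0].
have /finite_setP[n /card_esym] := finX.
move=> /(set_bij_of_card _ _ a0)[e [efun einj esurj]].
suff /(_ n (leqnn n))[g ag gE] : forall m, (m <= n)%N ->
    exists2 g : A -> A, automorphism g & forall i, (i < m)%N -> g (e i) = f (e i).
  by exists g => // u /esurj[i /= ltin <-]; exact: gE.
elim=> [_|m IHm ltmn]; first by exists id => //; exact: automorphism_id.
have [g ag gE] := IHm (ltnW ltmn).
have Xe i : (i <= m)%N -> X (e i) by move=> im; apply: efun; exact: leq_ltn_trans ltmn.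
have [[gfun ginj gsurj] grel] := ag.
(* The images of the first m points, which the correction must fix. *)
pose Z := [set f (e i) | i in `I_m].
have ne i : (i < m)%N -> e i <> e m.
  move=> im eim; suff imE : i = m by rewrite imE ltnn in im.
  by apply: einj; rewrite ?inE//=; exact: ltn_trans ltmn.
have [] := move_point Z (g (e m)) (f (e m)).
- move=> [i /= im]; rewrite -gE// => /ginj; rewrite !inE => /(_ I I).
  exact: ne.
- move=> [i /= im] /finj; rewrite !inE => /(_ (Xe _ (ltnW im)) (Xe _ (leqnn m))).
  exact: ne.
- move=> _ [i /= im <-]; rewrite -{1}gE// -grel// -frel//; apply: Xe => //.
  exact: ltnW.
- apply: card_eq_trans (fcard _ (Xe _ (leqnn m))).
  exact/card_esym/card_class_automorphism.
move=> t at_ [tv tZ]; exists (t \o g); first exact: automorphism_comp.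
move=> i; rewrite ltnS leq_eqVlt => /predU1P[->//|im] /=.
by rewrite gE// tZ//; exists i.
Qed.

Definition disjoint_class S c := forall s, S s -> ~ erel c s.

(** A partial isomorphism fixing [S] sends a point related to [s] in [S] to a point
    of the same class, and a point whose class is disjoint from [S] to another
    such point; so it preserves the sizes of classes as soon as the classes
    disjoint from [S] all have the same size. *)
Lemma exceptional_setP S : finite_set S ->
  exceptional_set S <->
  (forall c d, disjoint_class S c -> disjoint_class S d ->
     (class_of c #= class_of d)%card).
Proof.
move=> finS; split=> [[_ exS] c d Sc Sd|cardS]; last first.
  split=> // n x y f isof fS _; have [_ frel] := isof; apply: extend_partial_isomorphism isof _.
    by rewrite finite_setU; split=> //; exact: finite_image finite_finset.
  move=> u Xu; have [[s Ss us]|nu] := pselect (exists2 s, S s & erel u s).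
    have := us; rewrite (frel u s Xu (or_introl Ss)) (fS s Ss) => fus.
    by rewrite (class_of_eq _ _ us) (class_of_eq _ _ fus) card_eqxx.
  apply: cardS => s Ss us; apply: nu; exists s => //.
  by rewrite (frel u s Xu (or_introl Ss)) (fS s Ss).
have nS a s : disjoint_class S a -> S s -> s <> a.
  by move=> Sa Ss sa; apply: (Sa s) => //; rewrite sa.
(* The map that fixes S and sends c to d is a partial isomorphism, since neither
   c nor d is related to a point of S. *)
pose f u := if pselect (u = c) then d else u.
have fc : f c = d by rewrite /f; case: pselect.
have fS s : S s -> f s = s.
  by rewrite /f; case: pselect => // sc /(nS _ _ Sc).
have [||g ag gE] := exS 1%N (fun=> c) (fun=> d) f _ fS; last first.
- rewrite -fc -gE; last by right; exists ord0.
  exact: card_class_automorphism.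
- by [].
split; first split.
- by move=> u [Su|[_ _ <-]]; [left; rewrite fS|right; exists ord0].
- move=> u v; rewrite !inE => -[Su|[_ _ <-]] [Sv|[_ _ <-]]; rewrite ?fc ?fS//.
  + by move=> /(nS _ _ Sd Su).
  + by move=> /esym /(nS _ _ Sd Sv).
- move=> u [Su|[_ _ <-]]; first by exists u; [left|rewrite fS].
  by exists c => //; right; exists ord0.
move=> u v [Su|[_ _ <-]] [Sv|[_ _ <-]]; rewrite ?fc ?fS//.
- by split=> /erel_sym; [move=> /(Sc _ Su)|move=> /(Sd _ Su)].
- by split; [move=> /(Sc _ Sv)|move=> /(Sd _ Sv)].
Qed.

(** * Common sizes and exceptional sets *)

Lemma finite_classes_meeting S : finite_set S ->
  finite_set [set C | classes A C /\ exists2 s, S s & C s].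
Proof.
move=> finS; apply: sub_finite_set (finite_image class_of finS).
move=> _ [[c ->] [s Ss cs]]; exists s => //.
exact/esym/class_of_eq.
Qed.

Lemma exceptional_class_meets S c k C :
  exceptional_set S -> disjoint_class S c -> has_size (class_of c) k ->
  exceptional_classes A k C -> exists2 s, S s & C s.
Proof.
move=> exS Sc ck [[d ->] dk]; apply: contrapT => nd; apply: dk.
apply: card_has_size ck; apply: (exceptional_setP _ exS.1).1 => //.
by move=> s Ss ds; apply: nd; exists s.
Qed.

Lemma disjoint_class_common_size S c k :
  exceptional_set S -> disjoint_class S c -> has_size (class_of c) k ->
  common_size A k.
Proof.
move=> exS Sc ck; split; first by exists (class_of c) => //; exists c.
apply: sub_finite_set (finite_classes_meeting _ exS.1) => C exC.
by split; [case: exC|exact: exceptional_class_meets exS Sc ck exC].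
Qed.

Lemma carrier_inhabited : [set: A] !=set0.
Proof.
have [f [_ _ fsurj]] := set_bij_of_card _ _ 0 _ _ (carrier_countably_infinite A).
by have [a] := fsurj 0 I; exists a.
Qed.

Lemma exceptional_set_common_size S :
  exceptional_set S -> exists k : class_size, common_size A k.
Proof.
move=> exS; have [[c Sc]|nS] := pselect (exists c, disjoint_class S c).
  have [k ck] := ex_has_size (class_of c).
  by exists k; exact: disjoint_class_common_size exS Sc ck.
have [a _] := carrier_inhabited; have [k ak] := ex_has_size (class_of a).
exists k; split; first by exists (class_of a) => //; exists a.
apply: sub_finite_set (finite_classes_meeting _ exS.1) => _ [[c ->] _].
split; first by exists c.
by apply: contrapT => nc; apply: nS; exists c => s Ss cs; apply: nc; exists s.
Qed.

Lemma common_size_weakly_ultrahomogeneous k :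
  common_size A k -> weakly_ultrahomogeneous A.
Proof.
move=> [_ fink]; have [a0 _] := carrier_inhabited.
have repP C : exists a, classes A C -> C a.
  have [[a ->]|nC] := pselect (classes A C); last by exists a0.
  by exists a => _; exact: erel_refl.
have [rep repE] := choice repP.
pose S := rep @` exceptional_classes A k.
have disjS c : disjoint_class S c -> has_size (class_of c) k.
  move=> Sc; apply: contrapT => nck.
  have cA : classes A (class_of c) by exists c.
  by apply: (Sc (rep (class_of c))); [exists (class_of c)|exact: (repE _ cA)].
exists S; apply/exceptional_setP; first exact: finite_image.
by move=> c d /disjS ck /disjS dk; exact: has_size_card ck dk.
Qed.

(** * Minimal exceptional sets *)

Lemma minimal_exceptional_setD1 S s :
  minimal_exceptional_set S -> S s -> ~ exceptional_set (S `\ s).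
Proof.
move=> [_ minS] Ss; apply: minS; split; first by move=> x [].
by move=> /(_ s Ss)[_]; apply.
Qed.

(** [s] meets every class that [t] meets, so [t] could be dropped. *)
Lemma minimal_exceptional_set_unrelated S s t :
  minimal_exceptional_set S -> S s -> S t -> erel s t -> s = t.
Proof.
move=> minS Ss St st; apply: contrapT => nst.
have [exS _] := minS.
apply: (minimal_exceptional_setD1 S t) => //.
have sub c : disjoint_class (S `\ t) c -> disjoint_class S c.
  move=> Sc x Sx cx; have [xt|nxt] := pselect (x = t); last exact: (Sc x).
  by apply: (Sc s) => //; rewrite xt in cx; exact: erel_trans cx (erel_sym st).
apply/exceptional_setP; first exact: finite_setD exS.1.
by move=> c d /sub Sc /sub Sd; exact: (exceptional_setP _ exS.1).1.
Qed.

(** If every class met [S], then after dropping [s] only the class of [s] could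
    be disjoint from the rest, and a single class has a single size. *)
Lemma minimal_exceptional_set_disjoint_class S :
  minimal_exceptional_set S -> exists c, disjoint_class S c.
Proof.
move=> minS; apply: contrapT => nS.
have meet c : exists2 s, S s & erel c s.
  by apply: contrapT => nc; apply: nS; exists c => s Ss cs; apply: nc; exists s.
have [a _] := carrier_inhabited; have [s Ss _] := meet a.
apply: (minimal_exceptional_setD1 S s) => //.
have only_s c : disjoint_class (S `\ s) c -> erel c s.
  move=> Sc; have [x Sx cx] := meet c.
  have [<-//|xs] := pselect (x = s).
  by have := Sc x; case.
apply/exceptional_setP; first exact: finite_setD minS.1.1.
move=> c d /only_s cs /only_s ds.
by rewrite (class_of_eq _ _ cs) (class_of_eq _ _ ds) card_eqxx.
Qed.

Lemma minimal_exceptional_set_one_from_each S :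
  minimal_exceptional_set S ->
  exists k : class_size,
    common_size A k /\ one_from_each S (exceptional_classes A k).
Proof.
move=> minS; have [c Sc] := minimal_exceptional_set_disjoint_class _ minS.
have [k ck] := ex_has_size (class_of c); exists k.
split; first exact: disjoint_class_common_size minS.1 Sc ck.
move=> C exC; have [s Ss Cs] := exceptional_class_meets _ _ _ _ minS.1 Sc ck exC.
exists s; split=> // t [St Ct]; apply: (minimal_exceptional_set_unrelated S s t) => //.
have [[d Cd] _] := exC; rewrite Cd /= in Cs Ct.
exact: erel_trans (erel_sym Cs) Ct.
Qed.

End EquivStructure.

(* If A has finitely many classes, every size of a class is a common size, and
   which classes are exceptional depends on the one that is chosen: S
   determines the choice. *)
Theorem theorem4p1 (A : equivStructure) :
  (weakly_ultrahomogeneous A <-> exists k : class_size, common_size A k) /\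
  (weakly_ultrahomogeneous A ->
   forall S : set A, minimal_exceptional_set S ->
     (exists k : class_size,
        common_size A k /\ one_from_each S (exceptional_classes A k)) /\
     (infinite_set (classes A) ->
      forall k : class_size, common_size A k ->
        one_from_each S (exceptional_classes A k))).
Proof.
split.
  split=> [[S]|[k]]; first exact: exceptional_set_common_size.
  exact: common_size_weakly_ultrahomogeneous.
move=> _ S /minimal_exceptional_set_one_from_each[k [Ak Sk]].
split=> [|infA l Al]; first by exists k.
by rewrite (common_size_unique infA Al Ak).
Qed.
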